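(* Let $\mathbf B$ be a non-trivial involutive bisemilattice whose Płonka sum representation $\langle\{\mathbf A_i\}_{i\in I},I,p_{ij}\rangle$ contains no trivial Boolean algebra, let $\mathbf A_\infty$ be its Booleanisation and $\mathbf A_\infty^{*}$ the Stone space of $\mathbf A_\infty$, and let $s\colon B\to[0,1]$ be a state. Then: (1) there is a bijection $\chi\colon\mathcal S(\mathbf B)\to\mathcal M(\mathbf A_\infty^{*})$, where $\mathcal M(\mathbf A_\infty^{*})$ is the set of all regular Borel probability measures on $\mathbf A_\infty^{*}$; (2) for every $b\in B$, $$s(b)=\int_{\mathbf A_\infty^{*}}\widehat{[b]_\sim}(M)\,d\mu_s(M),$$ where $\mu_s=\chi(s)$ and $\widehat{[b]_\sim}\colon\mathbf A_\infty^{*}\to[0,1]$ is the unique continuous function associated to $[b]_\sim\in A_\infty$ (namely $\widehat{[b]_\sim}(M)=1$ if $[b]_\sim\in M$ and $0$ otherwise, for ultrafilters $M$).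
   Context: An involutive bisemilattice is an algebra $\mathbf B=\langle B,\wedge,\vee,',0,1\rangle$ of type $(2,2,1,0,0)$ satisfying $x\vee x\approx x$, $x\vee y\approx y\vee x$, $x\vee(y\vee z)\approx(x\vee y)\vee z$, $(x')'\approx x$, $x\wedge y\approx(x'\vee y')'$, $x\wedge(x'\vee y)\approx x\wedge y$, $0\vee x\approx x$, $1\approx 0'$. Every involutive bisemilattice is (canonically) the Płonka sum of a semilattice direct system of Boolean algebras, and $\mathbf B$ is identified with it: a join-semilattice $(I,\vee)$ with least element $i_0$, Boolean algebras $\mathbf A_i$ with pairwise disjoint universes, Boolean homomorphisms $p_{ij}\colon\mathbf A_i\to\mathbf A_j$ ($i\le j$) with $p_{ii}=\mathrm{id}$, $p_{ik}=p_{jk}\circ p_{ij}$; $B=\bigsqcup_iA_i$; for $a\in A_i$, $b\in A_j$, $k=i\vee j$: $a\wedge b=p_{ik}(a)\wedge^{\mathbf A_k}p_{jk}(b)$, $a\vee b=p_{ik}(a)\vee^{\mathbf A_k}p_{jk}(b)$; $a'$ computed in the algebra containing $a$; $0,1$ those of $\mathbf A_{i_0}$. $0_i,1_i$ are bottom and top of $\mathbf A_i$. A state is a map $s\colon B\to[0,1]$ with $s(1)=1$ and $s(a\vee b)=s(a)+s(b)$ whenever $a\wedge b\in\{0_i:i\in I\}$; $\mathcal S(\mathbf B)$ is the set of states. Booleanisation: for $a\in A_i$, $b\in A_j$, $a\sim b$ iff there is $k\ge i,j$ with $p_{ik}(a)=p_{jk}(b)$; $\mathbf A_\infty=B/{\sim}$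 is the direct limit Boolean algebra. The Stone space of a Boolean algebra is its space of ultrafilters with the Stone topology. *)

(* Defs.v *)
From HB Require Import structures.
From mathcomp Require Import all_boot all_order all_algebra generic_quotient.
From mathcomp Require Import all_classical all_reals all_analysis.

Set Implicit Arguments.
Unset Strict Implicit.
Unset Printing Implicit Defensive.

Import Order.Theory GRing.Theory Num.Theory.

HB.mixin Record isInvBisemilattice (T : Type) := {
  ibs_join : T -> T -> T;
  ibs_meet : T -> T -> T;
  ibs_inv : T -> T;
  ibs_zero : T;
  ibs_one : T;
  ibs_joinxx : forall x, ibs_join x x = x;
  ibs_joinC : forall x y, ibs_join x y = ibs_join y x;
  ibs_joinA : forall x y z,
    ibs_join x (ibs_join y z) = ibs_join (ibs_join x y) z;
  ibs_invK : forall x, ibs_inv (ibs_inv x) = x;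
  ibs_meetE : forall x y,
    ibs_meet x y = ibs_inv (ibs_join (ibs_inv x) (ibs_inv y));
  ibs_meetV : forall x y, ibs_meet x (ibs_join (ibs_inv x) y) = ibs_meet x y;
  ibs_join0x : forall x, ibs_join ibs_zero x = x;
  ibs_oneE : ibs_one = ibs_inv ibs_zero
}.

#[short(type="invBisemilatticeType")]
HB.structure Definition InvBisemilattice := {T of isInvBisemilattice T}.

Definition ibs_isomorphism (B C : invBisemilatticeType) (f : B -> C) : Prop :=
  [/\ bijective f,
      {morph f : x y / ibs_meet x y},
      {morph f : x y / ibs_join x y},
      {morph f : x / ibs_inv x} &
      f ibs_zero = ibs_zero /\ f ibs_one = ibs_one].

Section DirectSystem.
Local Open Scope order_scope.

(* The library's {tblmorphism _ -> _} only preserves \bot and \top, so Boolean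
   homomorphisms are spelled out. *)
Definition boolean_hom d d' (A : ctbDistrLatticeType d)
    (A' : ctbDistrLatticeType d') (f : A -> A') : Prop :=
  [/\ {morph f : x y / x `&` y},
      {morph f : x y / x `|` y},
      {morph f : x / ~` x},
      f \bot = \bot &
      f \top = \top].

(* The library's Boolean algebras (ctbDistrLatticeType) may satisfy
   \bot = \top. *)
Record direct_system (d d' : Order.disp_t) := DirectSystem {
  ds_index : bJoinSemilatticeType d;
  ds_alg : ds_index -> ctbDistrLatticeType d';
  ds_map : forall i j : ds_index, i <= j -> ds_alg i -> ds_alg j;
  ds_map_hom : forall (i j : ds_index) (ij : i <= j), boolean_hom (ds_map ij);
  ds_map_id : forall (i : ds_index) (ii : i <= i) (x : ds_alg i),
    ds_map ii x = x;
  ds_map_comp : forall (i j k : ds_index) (ij : i <= j) (jk : j <= k)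
      (ik : i <= k) (x : ds_alg i),
    ds_map ik x = ds_map jk (ds_map ij x)
}.

Definition nontrivial d (A : ctbDistrLatticeType d) : Prop :=
  (\bot : A) <> \top.

Definition no_trivial_algebra d d' (S : direct_system d d') : Prop :=
  forall i : ds_index S, nontrivial (ds_alg i).

End DirectSystem.

Section PlonkaSum.
Local Open Scope quotient_scope.
Local Open Scope order_scope.
Context {d d' : Order.disp_t} (S : direct_system d d').
Local Notation I := (ds_index S).
Local Notation A := (@ds_alg d d' S).

Definition plonka : Type := {i : I & A i}.

HB.instance Definition _ := Choice.on plonka.

Definition pl_elt (i : I) (x : A i) : plonka := existT A i x.

Definition pl_join (x y : plonka) : plonka :=
  let k := tag x `|` tag y in
  let a : A k := ds_map (leUl (tag x) (tag y)) (tagged x) in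
  let b : A k := ds_map (leUr (tag y) (tag x)) (tagged y) in
  pl_elt (a `|` b).

Definition pl_meet (x y : plonka) : plonka :=
  let k := tag x `|` tag y in
  let a : A k := ds_map (leUl (tag x) (tag y)) (tagged x) in
  let b : A k := ds_map (leUr (tag y) (tag x)) (tagged y) in
  pl_elt (a `&` b).

Definition pl_inv (x : plonka) : plonka := pl_elt (~` tagged x).

Definition pl_zero : plonka := pl_elt (\bot : A \bot).

Definition pl_one : plonka := pl_elt (\top : A \bot).

Lemma ds_mapI (i j : I) (h : i <= j) x y :
  ds_map h (x `&` y) = ds_map h x `&` ds_map h y.
Proof. by case: (ds_map_hom h). Qed.

Lemma ds_mapU (i j : I) (h : i <= j) x y :
  ds_map h (x `|` y) = ds_map h x `|` ds_map h y.
Proof. by case: (ds_map_hom h). Qed.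

Lemma ds_mapC (i j : I) (h : i <= j) x : ds_map h (~` x) = ~` ds_map h x.
Proof. by case: (ds_map_hom h). Qed.

Lemma ds_map0 (i j : I) (h : i <= j) : ds_map h \bot = \bot.
Proof. by case: (ds_map_hom h). Qed.

Lemma ds_map1 (i j : I) (h : i <= j) : ds_map h \top = \top.
Proof. by case: (ds_map_hom h). Qed.

Lemma ds_mapK (i j k : I) (ij : i <= j) (jk : j <= k) (ik : i <= k) x :
  ds_map jk (ds_map ij x) = ds_map ik x.
Proof. by rewrite (ds_map_comp ij jk). Qed.

Lemma pl_eq (x y : plonka) : tag x = tag y ->
  (forall k (hx : tag x <= k) (hy : tag y <= k),
     ds_map hx (tagged x) = ds_map hy (tagged y)) -> x = y.
Proof.
case: x y => [i x] [j y] /= ij; subst j => /(_ i (lexx i) (lexx i)).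
by rewrite !ds_map_id => ->.
Qed.

Let le_joinl (i j k : I) : i `|` j <= k -> i <= k.
Proof. exact/le_trans/leUl. Qed.
Let le_joinr (i j k : I) : i `|` j <= k -> j <= k.
Proof. exact/le_trans/leUr. Qed.

Lemma ds_map_pl_join x y k (h : tag (pl_join x y) <= k)
    (hx : tag x <= k) (hy : tag y <= k) :
  ds_map h (tagged (pl_join x y)) =
  ds_map hx (tagged x) `|` ds_map hy (tagged y).
Proof. by rewrite /= ds_mapU !ds_mapK. Qed.

Lemma ds_map_pl_meet x y k (h : tag (pl_meet x y) <= k)
    (hx : tag x <= k) (hy : tag y <= k) :
  ds_map h (tagged (pl_meet x y)) =
  ds_map hx (tagged x) `&` ds_map hy (tagged y).
Proof. by rewrite /= ds_mapI !ds_mapK. Qed.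

Lemma pl_joinxx x : pl_join x x = x.
Proof.
apply: pl_eq => [|k h hx]; first exact: joinxx.
by rewrite (ds_map_pl_join _ hx hx) joinxx.
Qed.

Lemma pl_joinC x y : pl_join x y = pl_join y x.
Proof.
apply: pl_eq => [|k h h']; first exact: joinC.
have hx := le_joinl h; have hy := le_joinr h.
by rewrite (ds_map_pl_join _ hx hy) (ds_map_pl_join _ hy hx) joinC.
Qed.

Lemma pl_joinA x y z : pl_join x (pl_join y z) = pl_join (pl_join x y) z.
Proof.
apply: pl_eq => [|k h h']; first exact: joinA.
have hx := le_joinl h; have hyz := le_joinr h.
have hxy := le_joinl h'; have hz := le_joinr h'.
have hy := le_joinl hyz.
rewrite (ds_map_pl_join _ hx hyz) (ds_map_pl_join _ hy hz).
by rewrite (ds_map_pl_join _ hxy hz) (ds_map_pl_join _ hx hy) joinA.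
Qed.

Lemma pl_invK x : pl_inv (pl_inv x) = x.
Proof. by case: x => i x; rewrite /pl_inv /= complK. Qed.

Lemma pl_meetE x y : pl_meet x y = pl_inv (pl_join (pl_inv x) (pl_inv y)).
Proof.
by rewrite /pl_meet /pl_inv /pl_join /= complU !ds_mapC !complK.
Qed.

Lemma pl_meetV x y : pl_meet x (pl_join (pl_inv x) y) = pl_meet x y.
Proof.
apply: pl_eq => [|k h h']; first by rewrite /= joinA joinxx.
have hx := le_joinl h'; have hy := le_joinr h'; have hxy := le_joinr h.
rewrite (ds_map_pl_meet _ hx hxy) (ds_map_pl_meet _ hx hy).
rewrite (@ds_map_pl_join (pl_inv x) y _ _ hx hy) /= ds_mapC.
by rewrite meetUr meetxC join0x.
Qed.

Lemma pl_join0x x : pl_join pl_zero x = x.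
Proof.
apply: pl_eq => [|k h hx]; first exact: join0x.
by rewrite (ds_map_pl_join _ (le0x k : tag pl_zero <= k) hx) /= ds_map0 join0x.
Qed.

Lemma pl_oneE : pl_one = pl_inv pl_zero.
Proof. by rewrite /pl_inv /= compl0. Qed.

HB.instance Definition _ := isInvBisemilattice.Build plonka
  pl_joinxx pl_joinC pl_joinA pl_invK pl_meetE pl_meetV pl_join0x pl_oneE.

Definition pl_equiv (x y : plonka) : bool :=
  `[< exists k (hx : tag x <= k) (hy : tag y <= k),
        ds_map hx (tagged x) = ds_map hy (tagged y) >].

Lemma pl_equivP x y :
  reflect (exists k (hx : tag x <= k) (hy : tag y <= k),
             ds_map hx (tagged x) = ds_map hy (tagged y)) (pl_equiv x y).
Proof. exact: asboolP. Qed.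

Lemma pl_equiv_refl : reflexive pl_equiv.
Proof. by move=> x; apply/pl_equivP; exists (tag x), (lexx _), (lexx _). Qed.

Lemma pl_equiv_sym : symmetric pl_equiv.
Proof.
by move=> x y; apply/pl_equivP/pl_equivP => -[k [hx [hy e]]];
  exists k, hy, hx.
Qed.

Lemma pl_equiv_trans : transitive pl_equiv.
Proof.
move=> y x z /pl_equivP[k [hx [hy exy]]] /pl_equivP[l [hy' [hz eyz]]].
apply/pl_equivP; exists (k `|` l).
exists (le_trans hx (leUl k l)), (le_trans hz (leUr l k)).
rewrite (ds_map_comp hx (leUl k l)) exy (ds_map_comp hz (leUr l k)) -eyz.
by rewrite !(ds_mapK _ _ (le_trans hy (leUl k l))).
Qed.

Canonical pl_equiv_rel :=
  EquivRel pl_equiv pl_equiv_refl pl_equiv_sym pl_equiv_trans.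

Definition booleanisation : Type := {eq_quot pl_equiv_rel}.

HB.instance Definition _ := Choice.on booleanisation.
HB.instance Definition _ := EqQuotient.on booleanisation.

Definition pl_class (x : plonka) : booleanisation := \pi_booleanisation x.

Lemma pl_classP x y : reflect (pl_class x = pl_class y) (pl_equiv x y).
Proof. exact: (@eqmodP _ pl_equiv_rel). Qed.

Lemma pl_class_repr (u : booleanisation) : pl_class (repr u) = u.
Proof. exact: reprK. Qed.

Lemma pl_class_eq x y k : tag x <= k -> tag y <= k ->
  (forall (hx : tag x <= k) (hy : tag y <= k),
     ds_map hx (tagged x) = ds_map hy (tagged y)) -> pl_class x = pl_class y.
Proof.
by move=> hx hy e; apply/pl_classP/pl_equivP; exists k, hx, hy; exact: e.
Qed.

Definition bz_join (u v : booleanisation) := pl_class (pl_join (repr u) (repr v)).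
Definition bz_meet (u v : booleanisation) := pl_class (pl_meet (repr u) (repr v)).
Definition bz_compl (u : booleanisation) := pl_class (pl_inv (repr u)).
Definition bz_bot : booleanisation := pl_class pl_zero.
Definition bz_top : booleanisation := pl_class pl_one.

Lemma pl_equiv_reprl x : pl_equiv (repr (pl_class x)) x.
Proof. by apply/pl_classP; rewrite pl_class_repr. Qed.

Let common x x' y y' : pl_equiv x x' -> pl_equiv y y' ->
  exists k (hx : tag x <= k) (hx' : tag x' <= k)
         (hy : tag y <= k) (hy' : tag y' <= k),
    ds_map hx (tagged x) = ds_map hx' (tagged x') /\
    ds_map hy (tagged y) = ds_map hy' (tagged y').
Proof.
move=> /pl_equivP[k [hx [hx' ex]]] /pl_equivP[l [hy [hy' ey]]].
have kl := leUl k l; have lk := leUr l k.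
exists (k `|` l), (le_trans hx kl), (le_trans hx' kl), (le_trans hy lk),
  (le_trans hy' lk).
by rewrite (ds_map_comp hx kl) (ds_map_comp hx' kl) (ds_map_comp hy lk)
  (ds_map_comp hy' lk) ex ey.
Qed.

Lemma bz_joinE x y : bz_join (pl_class x) (pl_class y) = pl_class (pl_join x y).
Proof.
have [k [hx [hx' [hy [hy' [ex ey]]]]]] :=
  common (pl_equiv_reprl x) (pl_equiv_reprl y).
have h : tag (repr (pl_class x)) `|` tag (repr (pl_class y)) <= k.
  by rewrite leUx hx hy.
have h' : tag x `|` tag y <= k by rewrite leUx hx' hy'.
eapply pl_class_eq; [exact: h|exact: h'|move=> ? ?].
by rewrite (ds_map_pl_join _ hx hy) (ds_map_pl_join _ hx' hy') ex ey.
Qed.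

Lemma bz_meetE x y : bz_meet (pl_class x) (pl_class y) = pl_class (pl_meet x y).
Proof.
have [k [hx [hx' [hy [hy' [ex ey]]]]]] :=
  common (pl_equiv_reprl x) (pl_equiv_reprl y).
have h : tag (repr (pl_class x)) `|` tag (repr (pl_class y)) <= k.
  by rewrite leUx hx hy.
have h' : tag x `|` tag y <= k by rewrite leUx hx' hy'.
eapply pl_class_eq; [exact: h|exact: h'|move=> ? ?].
by rewrite (ds_map_pl_meet _ hx hy) (ds_map_pl_meet _ hx' hy') ex ey.
Qed.

Lemma bz_complE x : bz_compl (pl_class x) = pl_class (pl_inv x).
Proof.
have [k [hx [hx' e]]] := pl_equivP _ _ (pl_equiv_reprl x).
eapply pl_class_eq; [exact: hx|exact: hx'|move=> p q].
by rewrite /= !ds_mapC (bool_irrelevance p hx) (bool_irrelevance q hx') e.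
Qed.

Lemma bzW (P : booleanisation -> Prop) :
  (forall x, P (pl_class x)) -> forall u, P u.
Proof. by move=> Px u; rewrite -(pl_class_repr u); exact: Px. Qed.

Let le_join2 (i j k : I) : i <= k -> j <= k -> i `|` j <= k.
Proof. by rewrite leUx => -> ->. Qed.

Lemma bz_meetC : commutative bz_meet.
Proof.
elim/bzW=> x; elim/bzW=> y; rewrite !bz_meetE !pl_meetE.
by rewrite pl_joinC.
Qed.

Lemma bz_joinC : commutative bz_join.
Proof. by elim/bzW=> x; elim/bzW=> y; rewrite !bz_joinE pl_joinC. Qed.

Lemma bz_meetA : associative bz_meet.
Proof.
elim/bzW=> x; elim/bzW=> y; elim/bzW=> z; rewrite !bz_meetE !pl_meetE.
by rewrite !pl_invK pl_joinA.
Qed.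

Lemma bz_joinA : associative bz_join.
Proof.
by elim/bzW=> x; elim/bzW=> y; elim/bzW=> z; rewrite !bz_joinE pl_joinA.
Qed.

Lemma bz_joinKI (v u : booleanisation) : bz_meet u (bz_join u v) = u.
Proof.
elim/bzW: u => x; elim/bzW: v => y; rewrite bz_joinE bz_meetE.
have hx := leUl (tag x) (tag y); have hy := leUr (tag y) (tag x).
have hxy : tag (pl_join x y) <= tag x `|` tag y := le_join2 hx hy.
have h := le_join2 hx hxy.
eapply pl_class_eq; [exact: h|exact: hx|move=> ? {}hx].
by rewrite (ds_map_pl_meet _ hx hxy) (ds_map_pl_join _ hx hy) joinKI.
Qed.

Lemma bz_meetKU (v u : booleanisation) : bz_join u (bz_meet u v) = u.
Proof.
elim/bzW: u => x; elim/bzW: v => y; rewrite bz_meetE bz_joinE.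
have hx := leUl (tag x) (tag y); have hy := leUr (tag y) (tag x).
have hxy : tag (pl_meet x y) <= tag x `|` tag y := le_join2 hx hy.
have h := le_join2 hx hxy.
eapply pl_class_eq; [exact: h|exact: hx|move=> ? {}hx].
by rewrite (ds_map_pl_join _ hx hxy) (ds_map_pl_meet _ hx hy) meetKU.
Qed.

Lemma bz_meetUl : left_distributive bz_meet bz_join.
Proof.
elim/bzW=> x; elim/bzW=> y; elim/bzW=> z; rewrite bz_joinE !bz_meetE bz_joinE.
pose k := tag x `|` tag y `|` tag z.
have hxy : tag (pl_join x y) <= k by exact: leUl.
have hx := le_joinl hxy; have hy := le_joinr hxy.
have hz : tag z <= k by exact: leUr.
have h := le_join2 hxy hz.
have hxz : tag (pl_meet x z) <= k := le_join2 hx hz.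
have hyz : tag (pl_meet y z) <= k := le_join2 hy hz.
have h' := le_join2 hxz hyz.
eapply pl_class_eq; [exact: h|exact: h'|move=> ? ?].
rewrite (ds_map_pl_meet _ hxy hz) (ds_map_pl_join _ hx hy).
rewrite (ds_map_pl_join _ hxz hyz) (ds_map_pl_meet _ hx hz).
by rewrite (ds_map_pl_meet _ hy hz) meetUl.
Qed.

Lemma bz_meetxx : idempotent_op bz_meet.
Proof.
by elim/bzW=> x; rewrite bz_meetE pl_meetE pl_joinxx pl_invK.
Qed.

Fact bz_display : Order.disp_t. Proof. exact: (Order.Disp tt tt). Qed.

HB.instance Definition _ :=
  @Order.isMeetJoinDistrLattice.Build bz_display booleanisation
    (fun u v => bz_meet u v == u)
    (fun u v => (v != u) && (bz_meet u v == u))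
    bz_meet bz_join (fun _ _ => erefl) (fun _ _ => erefl)
    bz_meetC bz_joinC bz_meetA bz_joinA bz_joinKI bz_meetKU bz_meetUl
    bz_meetxx.

Lemma bz_le0x (u : booleanisation) : bz_bot <= u.
Proof.
rewrite leEmeet; apply/eqP; elim/bzW: u => x.
rewrite [LHS]bz_meetE.
have h0 : tag pl_zero <= tag x by exact: le0x.
have h := le_join2 h0 (lexx (tag x)).
eapply pl_class_eq; [exact: h|exact: h0|move=> ? {}h0].
by rewrite (ds_map_pl_meet _ h0 (lexx _)) /= ds_map0 meet0x.
Qed.

Lemma bz_lex1 (u : booleanisation) : u <= bz_top.
Proof.
rewrite leEmeet; apply/eqP; elim/bzW: u => x.
rewrite [LHS]bz_meetE.
have h1 : tag pl_one <= tag x by exact: le0x.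
have h := le_join2 (lexx (tag x)) h1.
eapply pl_class_eq; [exact: h|exact: lexx|move=> ? hx].
by rewrite (ds_map_pl_meet _ hx h1) /= ds_map1 meetx1.
Qed.

HB.instance Definition _ :=
  @Order.hasBottom.Build bz_display booleanisation bz_bot bz_le0x.
HB.instance Definition _ :=
  @Order.hasTop.Build bz_display booleanisation bz_top bz_lex1.

Lemma bz_joinxC (u : booleanisation) : u `|` bz_compl u = \top.
Proof.
elim/bzW: u => x; rewrite bz_complE [LHS]bz_joinE.
have h1 : tag pl_one <= tag x by exact: le0x.
have h := le_join2 (lexx (tag x)) (lexx (tag x)).
eapply pl_class_eq; [exact: h|exact: h1|move=> ? {}h1].
rewrite (@ds_map_pl_join x (pl_inv x) _ _ (lexx _) (lexx _)) /=.
by rewrite ds_mapC ds_map1 joinxC.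
Qed.

Lemma bz_meetxC (u : booleanisation) : u `&` bz_compl u = \bot.
Proof.
elim/bzW: u => x; rewrite bz_complE [LHS]bz_meetE.
have h0 : tag pl_zero <= tag x by exact: le0x.
have h := le_join2 (lexx (tag x)) (lexx (tag x)).
eapply pl_class_eq; [exact: h|exact: h0|move=> ? {}h0].
rewrite (@ds_map_pl_meet x (pl_inv x) _ _ (lexx _) (lexx _)) /=.
by rewrite ds_mapC ds_map0 meetxC.
Qed.

HB.instance Definition _ :=
  @Order.TBDistrLattice_hasComplement.Build bz_display booleanisation
    bz_compl bz_joinxC bz_meetxC.

Lemma booleanisation_nontrivial :
  no_trivial_algebra S -> nontrivial booleanisation.
Proof.
move=> ntS /pl_classP/pl_equivP[k [h0 [h1]]].
by rewrite /= ds_map0 ds_map1 => /ntS.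
Qed.

End PlonkaSum.

Section StoneSpace.
Local Open Scope classical_set_scope.
Local Open Scope order_scope.
Context {d : Order.disp_t}.
Implicit Type A : ctbDistrLatticeType d.

Definition proper_boolean_filter A (F : set A) : Prop :=
  [/\ F \top,
      forall x y, F x -> F y -> F (x `&` y)%O,
      forall x y, x <= y -> F x -> F y &
      ~ F \bot].

Definition boolean_ultrafilter A (F : set A) : Prop :=
  proper_boolean_filter F /\
  forall G : set A, proper_boolean_filter G -> (F `<=` G)%classic -> G = F.

Record stone A := Stone {
  stone_set : set A;
  stone_setP : boolean_ultrafilter stone_set
}.

HB.instance Definition _ A := gen_eqMixin (stone A).
HB.instance Definition _ A := gen_choiceMixin (stone A).

Definition stone_basic A (a : A) : set (stone A) :=
  [set M | stone_set M a]%classic.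

Lemma stone_basic_cover A :
  (\bigcup_(U in range (@stone_basic A)) U = setT)%classic.
Proof.
rewrite -subTset => M _; exists (stone_basic \top); first by exists \top.
by case: (stone_setP M) => -[].
Qed.

Lemma stone_basic_join A (U V : set (stone A)) (M : stone A) :
  range (@stone_basic A) U -> range (@stone_basic A) V -> U M -> V M ->
  exists W, [/\ range (@stone_basic A) W, W M & (W `<=` U `&` V)%classic].
Proof.
move=> [a _ <-] [b _ <-] Ma Mb; exists (stone_basic (a `&` b)%O).
split; first by exists (a `&` b)%O.
  by case: (stone_setP M) => -[_ + _ _] _; exact.
move=> N; rewrite /stone_basic /= => Nab.
by case: (stone_setP N) => -[_ _ up _] _; split; apply: up Nab;
  [exact: leIl|exact: leIr].
Qed.

HB.instance Definition _ A :=
  isBaseTopological.Build (stone A) (stone_basic_cover A)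
    (@stone_basic_join A).

Lemma boolean_ultrafilter_exists A :
  nontrivial A -> exists F : set A, boolean_ultrafilter F.
Proof.
move=> ntA.
have top_le (x : A) : \top <= x -> x = \top by rewrite le1x => /eqP.
pose P (F : set A) := proper_boolean_filter (F `|` [set \top])%classic.
have [C CP totC|F [PF maxF]] := @Zorn_bigcup A P.
  split; first by right.
  - move=> x y [[X CX Xx]|->] [[Y CY Yy]|->]; last by right; rewrite meetxx.
    + have [XY|YX] := totC _ _ CX CY.
      * have [_ + _ _] := CP _ CY => /(_ x y (or_introl (XY _ Xx)) (or_introl Yy)).
        by case=> [h|->]; [left; exists Y|right].
      * have [_ + _ _] := CP _ CX => /(_ x y (or_introl Xx) (or_introl (YX _ Yy))).
        by case=> [h|->]; [left; exists X|right].
    + by rewrite meetx1; left; exists X.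
    + by rewrite meet1x; left; exists Y.
  - move=> x y xy [[X CX Xx]|xT].
      have [_ _ + _] := CP _ CX => /(_ x y xy (or_introl Xx)).
      by case=> [h|->]; [left; exists X|right].
    by right; apply: top_le; rewrite -xT.
  - move=> [[X CX X0]|/ntA//].
    by have [_ _ _ +] := CP _ CX; apply; left.
exists (F `|` [set \top])%classic; split => // G pG FG.
apply/seteqP; split => //; apply: contrapT => GF.
have GE : (G `|` [set \top] = G)%classic.
  apply/seteqP; split => [x [//|->]|x Gx]; last by left.
  by case: pG.
apply: (maxF G); last by rewrite /P GE.
by split=> [x Fx|GF']; [apply: FG; left|apply: GF => x /GF' Fx; left].
Qed.

Lemma stone_inhabited A : nontrivial A -> exists _ : stone A, True.
Proof. by move=> /boolean_ultrafilter_exists[F uF]; exists (Stone uF). Qed.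

(* The library's measurable types must be inhabited; the Stone space of A is
   inhabited as soon as A is nontrivial. *)
Definition stone_space A (ntA : nontrivial A) : Type := stone A.

HB.instance Definition _ A (ntA : nontrivial A) :=
  Topological.on (stone_space ntA).
HB.instance Definition _ A (ntA : nontrivial A) :=
  isPointed.Build (stone_space ntA) (projT1 (cid (stone_inhabited ntA))).

End StoneSpace.

Section RegularMeasures.
Local Open Scope classical_set_scope.
Local Open Scope ereal_scope.

Definition borel (X : ptopologicalType) := g_sigma_algebraType (@open X).

Definition regular_measure (R : realType) (X : ptopologicalType)
    (mu : set (borel X) -> \bar R) : Prop :=
  forall E : set (borel X), measurable E ->
    mu E = ereal_inf [set mu U | U in [set U : set X | open U /\ E `<=` U]] /\
    mu E = ereal_sup [set mu K | K in [set K : set X | compact K /\ K `<=` E]].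

(* Library measures are functions on all subsets, constrained only on the
   measurable ones. Fixing the value 0 outside the Borel sets selects exactly one
   representative of each Borel measure, so that equality in this set is
   equality of measures on Borel sets. *)
Definition regular_probabilities (R : realType) (X : ptopologicalType) :
    set (probability (borel X) R) :=
  [set mu | regular_measure mu /\
     forall E : set (borel X), ~ measurable E -> mu E = 0].

End RegularMeasures.

Section States.
Local Open Scope classical_set_scope.
Local Open Scope ring_scope.
Context {R : realType} {B : invBisemilatticeType} {d d' : Order.disp_t}.

(* The zeros 0_i of the components of the Plonka sum, seen in B through the
   identification f of B with that sum. *)
Definition local_zeros (S : direct_system d d') (f : B -> plonka S) : set B :=
  [set b | exists i : ds_index S, f b = pl_elt (\bot%O : ds_alg i)].

Definition states (S : direct_system d d') (f : B -> plonka S) :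
    set (B -> R) :=
  [set s | [/\ forall b, 0 <= s b <= 1,
               s ibs_one = 1 &
               forall a b, local_zeros f (ibs_meet a b) ->
                 s (ibs_join a b) = s a + s b]].

End States.

(* Main.v *)
(* A state vanishes on every local zero 0_i and, joining with 0_j, is constant
   along the maps p_ij; states are thus the finitely additive probabilities m on
   the Booleanisation A, composed with the quotient map. Such an m extends to
   the Stone space: give an open set U the supremum of m a over the clopen sets
   [stone_basic a] contained in U, and an arbitrary set E the infimum over the
   open sets containing E. By compactness of clopen sets this is an outer
   measure; open sets are Caratheodory measurable for it, so that it restricts to
   a Borel measure, outer regular by construction and inner regular by taking
   complements. The clopen values determine a regular measure, since a clopen set
   fits between any compact set and any open set containing it. *)
Require Import Defs.
From HB Require Import structures.
From mathcomp Require Import all_boot all_order all_algebra.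
From mathcomp Require Import all_classical all_reals all_analysis.
From mathcomp Require Import lra.

Set Implicit Arguments.
Unset Strict Implicit.
Unset Printing Implicit Defensive.

Import Order.Theory GRing.Theory Num.Theory.
Local Open Scope classical_set_scope.
Local Open Scope ring_scope.

(** * Stone spaces *)

Section StoneDuality.
Local Open Scope order_scope.
Context {d : Order.disp_t} {A : ctbDistrLatticeType d}.
Implicit Types (a b : A) (F : set A) (U : set (stone A)) (M : stone A).

(** If neither [a] nor its complement lay in [F], the filter generated by [F] and [a] would still be
    proper, since a [y] in [F] disjoint from [a] lies below the complement of [a]. By maximality it
    would equal [F], which would then contain [a]. *)
Lemma boolean_ultrafilter_compl F a :
  boolean_ultrafilter F -> F a \/ F (~` a).
Proof.
move=> [[F1 FI Fle F0] maxF]; apply: contrapT => /not_orP[nFa nFCa].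
pose G := [set x | exists2 y, F y & y `&` a <= x].
have GF : G = F.
  apply: maxF => [|x Fx]; last by exists x => //; exact: leIl.
  split.
  - by exists \top => //; exact: lex1.
  - move=> x y [x' Fx' xx'] [y' Fy' yy']; exists (x' `&` y'); first exact: FI.
    rewrite lexI (le_trans _ xx') ?(le_trans _ yy')//; apply: leI2 => //.
      exact: leIr.
    exact: leIl.
  - by move=> x y xy [z Fz zx]; exists z => //; exact: le_trans xy.
  - move=> [y Fy]; rewrite lex0 disj_leC => ya; apply: nFCa.
    exact: Fle ya Fy.
by apply: nFa; rewrite -GF; exists \top => //; exact: leIr.
Qed.

Lemma prime_boolean_ultrafilter F : proper_boolean_filter F ->
  (forall a, F a \/ F (~` a)) -> boolean_ultrafilter F.
Proof.
move=> pF primeF; split => // G [_ GI _ G0] FG.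
apply/seteqP; split => // x Gx; have [//|FCx] := primeF x.
by case: G0; rewrite -(meetxC x); apply: GI => //; exact: FG.
Qed.

Lemma boolean_ultrafilter_extend F0 : proper_boolean_filter F0 ->
  exists2 F, boolean_ultrafilter F & (F0 `<=` F)%classic.
Proof.
move=> pF0.
(* Zorn is applied to sets that become proper filters after union with [F0], so that the empty
   chain, whose union is empty, also satisfies the property. *)
pose P F := proper_boolean_filter (F `|` F0)%classic.
have [C CP totC|F [PF maxF]] := @Zorn_bigcup A P.
  rewrite /P; set H := (_ `|` _)%classic.
  (* Each filter axiom involves at most two members, and any two members of [H] already lie in one
     proper filter contained in [H]. *)
  have chain x y : H x -> H y -> exists2 G, proper_boolean_filter G &
      [/\ G x, G y & (G `<=` H)%classic].
    have sub X : C X -> (X `|` F0 `<=` H)%classic.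
      by move=> CX z [Xz|?]; [left; exists X|right].
    move=> [[X CX Xx]|F0x] [[Y CY Yy]|F0y].
    - by have [XY|YX] := totC _ _ CX CY;
        [exists (Y `|` F0)%classic|exists (X `|` F0)%classic];
        [exact: CP|split; [left; auto|left; auto|exact: sub]
        |exact: CP|split; [left; auto|left; auto|exact: sub]].
    - by exists (X `|` F0)%classic;
        [exact: CP|split; [left|right|exact: sub]].
    - by exists (Y `|` F0)%classic;
        [exact: CP|split; [right|left|exact: sub]].
    - by exists F0 => //; split=> // z F0z; right.
  split.
  - by right; case: pF0.
  - move=> x y /chain/[apply] -[G [_ GI _ _] [Gx Gy]]; apply.
    exact: GI.
  - move=> x y xy Hx; have [G [_ _ Gle _] [Gx _]] := chain _ _ Hx Hx.
    by apply; exact: Gle xy Gx.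
  - by move=> H0; have [G [_ _ _ G0] []] := chain _ _ H0 H0.
exists (F `|` F0)%classic; last by move=> x; right.
split=> // G pG FG; apply/seteqP; split => //; apply: contrapT => GF.
have GE : (G `|` F0 = G)%classic.
  by apply/seteqP; split => [x [//|F0x]|x]; [apply: FG; right|left].
apply: (maxF G); last by rewrite /P GE.
by split=> [x Fx|GF']; [apply: FG; left|apply: GF => x /GF' Fx; left].
Qed.

Lemma stone_basic0 : stone_basic (\bot : A) = set0.
Proof. by apply/seteqP; split=> // M; case: (stone_setP M) => -[]. Qed.

Lemma stone_basicT : stone_basic (\top : A) = setT.
Proof. by apply/seteqP; split=> // M _; case: (stone_setP M) => -[]. Qed.

Lemma stone_basicI a b :
  stone_basic (a `&` b) = (stone_basic a `&` stone_basic b)%classic.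
Proof.
apply/seteqP; split=> M; case: (stone_setP M) => -[_ MI Mle _] _.
  by move=> Mab; split; apply: Mle Mab; [exact: leIl|exact: leIr].
by move=> [Ma Mb]; exact: MI.
Qed.

Lemma stone_basicC a : stone_basic (~` a) = (~` stone_basic a)%classic.
Proof.
apply/seteqP; split=> M; case: (stone_setP M) => -[_ MI Mle M0] maxM.
  by move=> MCa Ma; apply: M0; rewrite -(meetxC a); exact: MI.
by move=> nMa; have [] := boolean_ultrafilter_compl a (stone_setP M).
Qed.

Lemma stone_basicU a b :
  stone_basic (a `|` b) = (stone_basic a `|` stone_basic b)%classic.
Proof.
by rewrite -(complK (a `|` b)) complU stone_basicC stone_basicI !stone_basicC
  setCI !setCK.
Qed.

(** A nonzero [a] generates a proper principal filter, and any ultrafilter extending it is a point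
    of [stone_basic a]. *)
Lemma stone_basic_eq0 a : stone_basic a = set0 -> a = \bot.
Proof.
move=> a0; apply: contrapT => na0.
have [|F uF aF] := @boolean_ultrafilter_extend [set x | a <= x].
  split=> [|x y /= ax ay|x y xy /= ax|/=]; first exact: lex1.
  - by rewrite lexI ax ay.
  - exact: le_trans xy.
  - by rewrite lex0 => /eqP.
have : stone_basic a (Stone uF) by apply: aF => /=.
by rewrite a0.
Qed.

Lemma stone_basic_subset a b :
  (stone_basic a `<=` stone_basic b)%classic -> a <= b.
Proof.
move=> ab; rewrite -(complK b) -disj_leC; apply/eqP/stone_basic_eq0.
by rewrite stone_basicI stone_basicC -setDE classical_sets.setD_eq0.
Qed.

Lemma open_stone_basic a : open (stone_basic a).
Proof.
exists [set stone_basic a] => [_ ->|]; first by exists a.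
by rewrite bigcup_set1.
Qed.

Lemma openP_stone_basic U :
  open U <-> forall M, U M ->
    exists2 a, stone_basic a M & (stone_basic a `<=` U)%classic.
Proof.
split=> [[D Dbasic <-] M [V DV VM]|basicU].
  have [a _ aV] := Dbasic _ DV.
  by exists a; rewrite aV//; exact: bigcup_sup.
rewrite openE => M /basicU[a aM aU].
by rewrite /interior nbhsE; exists (stone_basic a) => //; split=> //;
  exact: open_stone_basic.
Qed.

(** An ultrafilter of subsets converges to the point formed by those [a] whose clopen set it
    contains. *)
Lemma compact_stone : compact [set: stone A].
Proof.
rewrite compact_ultra => F uF _.
pose G := [set a | F (stone_basic a)].
have uG : boolean_ultrafilter G.
  apply: prime_boolean_ultrafilter => [|a].
    split.
    - by rewrite /G /= stone_basicT; exact: filterT.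
    - by move=> x y Gx Gy; rewrite /G /= stone_basicI; exact: filterI.
    - move=> x y xy; rewrite /G /= => Gx; apply: filterS Gx.
      by rewrite -(meet_l xy) stone_basicI; exact: subIsetr.
    - by rewrite /G /= stone_basic0; exact: filter_not_empty.
  by rewrite /G /= stone_basicC; exact: in_ultra_setVsetC.
exists (Stone uG); split=> // N; rewrite nbhsE => -[U [oU UG] UN].
have [a Ga aU] := (openP_stone_basic U).1 oU _ UG.
by apply: filterS Ga; exact: subset_trans UN.
Qed.

Lemma closed_stone_basic a : closed (stone_basic a).
Proof.
rewrite -[stone_basic a]setCK -stone_basicC.
by apply: open_closedC; exact: open_stone_basic.
Qed.

Lemma closed_stone_compact (K : set (stone A)) : closed K -> compact K.
Proof. by move=> cK; exact: subclosed_compact compact_stone _. Qed.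

(** An element of one ultrafilter missing from the other gives complementary clopen neighbourhoods.
    Points that cannot be separated are therefore included one in the other, hence equal by
    maximality. *)
Lemma hausdorff_stone : hausdorff_space (stone A).
Proof.
move=> [F uF] [G uG] clFG.
have FG : (F `<=` G)%classic.
  move=> a Fa; have [//|GCa] := boolean_ultrafilter_compl a uG.
  have [||M []] := clFG (stone_basic a) (stone_basic (~` a)).
  - by apply: open_nbhs_nbhs; split=> //; exact: open_stone_basic.
  - by apply: open_nbhs_nbhs; split=> //; exact: open_stone_basic.
  - by rewrite stone_basicC.
have GF := uF.2 G uG.1 FG.
by subst G; congr Stone; exact: Prop_irrelevance.
Qed.

(** If no member of [D] covers [K], the sets of points of [K] left uncovered by each [a] in [D]
    generate a proper filter, because [D] is closed under joins. Its cluster point in [K] lies in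
    some [stone_basic a], a neighbourhood that misses the part of [K] left by [a]. *)
Lemma compact_stone_basic_directed (K : set (stone A)) (D : set A) :
  compact K -> D \bot -> (forall a b, D a -> D b -> D (a `|` b)) ->
  (K `<=` \bigcup_(a in D) stone_basic a)%classic ->
  exists2 a, D a & (K `<=` stone_basic a)%classic.
Proof.
move=> cK D0 DU KD; apply: contrapT => nD.
pose F := [set N : set (stone A) |
  exists2 a, D a & (K `\` stone_basic a `<=` N)%classic].
have PF : ProperFilter F.
  apply: Build_ProperFilter_ex => [N [a Da KaN]|].
    have [M [KM nMa]] : (K `\` stone_basic a !=set0)%classic.
      apply/set0P/negP => /eqP; rewrite classical_sets.setD_eq0 => Ka.
      by apply: nD; exists a.
    by exists M; apply: KaN.
  split.
  - by exists \bot.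
  - move=> N N' [a Da aN] [b Db bN']; exists (a `|` b); first exact: DU.
    rewrite stone_basicU => M [KM /not_orP[nMa nMb]].
    by split; [exact: aN|exact: bN'].
  - by move=> N N' NN' [a Da aN]; exists a => //; exact: subset_trans NN'.
have FK : F K by exists \bot => // M [].
have [M [KM clM]] := cK F PF FK.
have [a Da aM] := KD _ KM.
have Fa : F (K `\` stone_basic a) by exists a.
have [|N [[_ nNa] /nNa//]] := clM _ (stone_basic a) Fa.
by apply: open_nbhs_nbhs; split=> //; exact: open_stone_basic.
Qed.

Lemma compact_sub_stone_basic (K U : set (stone A)) : compact K -> open U ->
  (K `<=` U)%classic ->
  exists a, (K `<=` stone_basic a)%classic /\ (stone_basic a `<=` U)%classic.
Proof.
move=> cK oU KU.
have [||M /KU UM|a aU Ka] := compact_stone_basic_directed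
    (D := [set a | (stone_basic a `<=` U)%classic]) cK.
- by rewrite /= stone_basic0; exact: sub0set.
- by move=> a b aU bU; rewrite /= stone_basicU subUset.
- by have [a aM aU] := (openP_stone_basic U).1 oU _ UM; exists a.
- by exists a.
Qed.

End StoneDuality.

(** * Regular extension of finitely additive probabilities *)

Section FinitelyAdditive.
Context {R : realType} {d : Order.disp_t} {A : ctbDistrLatticeType d}.

Definition boolean_probability (m : A -> R) : Prop :=
  [/\ forall a, 0 <= m a,
      m \top%O = 1 &
      forall a b, (a `&` b)%O = \bot%O -> m (a `|` b)%O = m a + m b].

Context (m : A -> R) (mP : boolean_probability m).
Implicit Types (a b : A) (E U V : set (stone A)).

Lemma boolean_probability_ge0 a : 0 <= m a.
Proof. by case: mP. Qed.

Lemma boolean_probabilityU a b :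
  (a `&` b)%O = \bot%O -> m (a `|` b)%O = m a + m b.
Proof. by case: mP => _ _; exact. Qed.

Lemma boolean_probability0 : m \bot%O = 0.
Proof.
have := @boolean_probabilityU \bot%O \bot%O (meetxx _).
by rewrite joinxx => /eqP; rewrite -subr_eq0 opprD addNKr oppr_eq0 => /eqP.
Qed.

Lemma boolean_probability_split a b :
  m a = m (a `&` b)%O + m (a `&` ~` b)%O.
Proof.
rewrite -boolean_probabilityU -?meetUr ?joinxC ?meetx1//.
by rewrite meetACA meetxC meetx0.
Qed.

Lemma le_boolean_probability a b : (a <= b)%O -> m a <= m b.
Proof.
move=> ab; rewrite (boolean_probability_split b a) (meet_r ab).
by rewrite lerDl boolean_probability_ge0.
Qed.

Lemma boolean_probability_le1 a : m a <= 1.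
Proof. by case: mP => _ <- _; exact/le_boolean_probability/lex1. Qed.

Local Open Scope ereal_scope.

Definition stone_inner U : \bar R :=
  ereal_sup [set (m a)%:E | a in [set a | stone_basic a `<=` U]].

Definition stone_outer E : \bar R :=
  ereal_inf [set stone_inner U | U in [set U | open U /\ E `<=` U]].

Lemma le_stone_inner a U : stone_basic a `<=` U -> (m a)%:E <= stone_inner U.
Proof. by move=> aU; apply: ereal_sup_ubound; exists a. Qed.

Lemma stone_inner_le U (x : \bar R) :
  (forall a, stone_basic a `<=` U -> (m a)%:E <= x) -> stone_inner U <= x.
Proof. by move=> Ux; apply: ge_ereal_sup => _ [a aU <-]; exact: Ux. Qed.

Lemma stone_inner_ge0 U : 0 <= stone_inner U.
Proof.
have <- : (m \bot%O)%:E = 0 by rewrite boolean_probability0.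
apply: le_stone_inner.
by rewrite stone_basic0; exact: sub0set.
Qed.

Lemma stone_inner_basic a : stone_inner (stone_basic a) = (m a)%:E.
Proof.
apply/eqP; rewrite eq_le le_stone_inner// andbT; apply: stone_inner_le => b ba.
by rewrite lee_fin; apply: le_boolean_probability; exact: stone_basic_subset.
Qed.

Lemma stone_innerS U V : U `<=` V -> stone_inner U <= stone_inner V.
Proof.
move=> UV; apply: stone_inner_le => a aU; apply: le_stone_inner.
exact: subset_trans UV.
Qed.

Lemma stone_outer_le E U : open U -> E `<=` U -> stone_outer E <= stone_inner U.
Proof. by move=> oU EU; apply: ereal_inf_lbound; exists U. Qed.

Lemma le_stone_outer E (x : \bar R) :
  (forall U, open U -> E `<=` U -> x <= stone_inner U) -> x <= stone_outer E.
Proof.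
by move=> xE; apply: le_ereal_inf_tmp => _ [U [oU EU] <-]; exact: xE.
Qed.

Lemma stone_outer_open U : open U -> stone_outer U = stone_inner U.
Proof.
move=> oU; apply/eqP; rewrite eq_le stone_outer_le//=.
by apply: le_stone_outer => V _; exact: stone_innerS.
Qed.

Lemma stone_outer_basic a : stone_outer (stone_basic a) = (m a)%:E.
Proof.
by rewrite stone_outer_open ?stone_inner_basic//; exact: open_stone_basic.
Qed.

Lemma stone_outer_ge0 E : 0 <= stone_outer E.
Proof. by apply: le_stone_outer => U _ _; exact: stone_inner_ge0. Qed.

Lemma stone_outer0 : stone_outer set0 = 0.
Proof. by rewrite -stone_basic0 stone_outer_basic boolean_probability0. Qed.

Lemma stone_outerS : {homo stone_outer : E E' / E `<=` E' >-> E <= E'}.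
Proof.
move=> E E' EE'; apply: le_stone_outer => U oU E'U; apply: stone_outer_le => //.
exact: subset_trans E'U.
Qed.

Lemma stone_outerT : stone_outer setT = 1.
Proof. by rewrite -stone_basicT stone_outer_basic; case: mP => _ -> _. Qed.

Lemma stone_outer_fin_num E : stone_outer E \is a fin_num.
Proof.
rewrite ge0_fin_numE ?stone_outer_ge0//.
by rewrite (le_lt_trans (stone_outerS (@subsetT _ E)))// stone_outerT ltry.
Qed.

(** The part of [stone_basic a] outside [V] is compact and lies in [U], so a clopen set [b] fits
    between the two; what remains of [a] outside [b] falls in [V]. *)
Lemma stone_basic_setU_sub a U V : open U -> open V ->
  stone_basic a `<=` U `|` V -> exists2 b, stone_basic b `<=` U &
    stone_basic (a `&` ~` b)%O `<=` V.
Proof.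
move=> oU oV aUV.
have [||M [aM nVM]|b [Kb bU]] :=
    @compact_sub_stone_basic _ A (stone_basic a `&` ~` V) U.
- apply: closed_stone_compact; apply: closedI; first exact: closed_stone_basic.
  exact: open_closedC.
- exact: oU.
- by have [|/nVM] := aUV _ aM.
exists b => // M; rewrite stone_basicI stone_basicC => -[aM nbM].
by apply: contrapT => nVM; apply: nbM; exact: Kb.
Qed.

(** Induction on [n]: a piece [b] goes to the first [n] sets and the rest of [a] to the last one. *)
Lemma stone_basic_bigcup_le (U : (set (stone A))^nat) n a :
  (forall i, open (U i)) -> stone_basic a `<=` \bigcup_(i in `I_n) U i ->
  (m a)%:E <= \sum_(0 <= i < n) stone_inner (U i).
Proof.
move=> oU; elim: n a => [|n IHn] a.
  rewrite II0 bigcup_set0 subset0 => /stone_basic_eq0 ->.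
  by rewrite big_geq// boolean_probability0.
rewrite IIS bigcup_setU bigcup_set1 => aU; rewrite big_nat_recr//=.
have [||b bU /le_stone_inner abU] := stone_basic_setU_sub _ _ aU => //.
  by apply: bigcup_open => i _.
apply: le_trans (leeD (IHn _ bU) abU).
rewrite -EFinD lee_fin (boolean_probability_split a b) lerD2r.
by apply: le_boolean_probability; exact: leIr.
Qed.

Lemma stone_inner_bigcup (U : (set (stone A))^nat) : (forall i, open (U i)) ->
  stone_inner (\bigcup_i U i) <= \sum_(i <oo) stone_inner (U i).
Proof.
move=> oU; apply: stone_inner_le => a aU.
(* Clopen sets covered by finitely many of the [U i] form a directed family, so compactness puts
   [stone_basic a] under one of them. *)
pose D := [set b | exists n, stone_basic b `<=` \bigcup_(i in `I_n) U i].
have [||b c [n bU] [n' cU]|M aM|b [n bU] ab] :=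
    @compact_stone_basic_directed _ A (stone_basic a) D.
- by apply: closed_stone_compact; exact: closed_stone_basic.
- by exists 0%N; rewrite stone_basic0; exact: sub0set.
- exists (maxn n n'); rewrite stone_basicU subUset; split.
    apply: subset_trans bU _; apply: bigcup_subset => i /= ni.
    by rewrite (leq_trans ni)// leq_maxl.
  apply: subset_trans cU _; apply: bigcup_subset => i /= ni.
  by rewrite (leq_trans ni)// leq_maxr.
- have [i _ /((openP_stone_basic _).1 (oU i))[b bM bU]] := aU _ aM.
  exists b => //; exists i.+1; apply: subset_trans bU _ => N UN.
  by exists i => /=.
apply: le_trans (stone_basic_bigcup_le oU (subset_trans ab bU)) _.
by apply: nneseries_lim_ge => i _ _; exact: stone_inner_ge0.
Qed.

Lemma stone_outer_sigma_subadditive : sigma_subadditive stone_outer.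
Proof.
move=> F; apply/lee_addgt0Pr => e e0.
(* The errors allowed for the open covers of the [F n] sum to at most [e]. *)
have H n : exists U, [/\ open U, F n `<=` U &
    stone_inner U <= stone_outer (F n) + (e / (2 ^ n.+1)%:R)%:E].
  have en0 : (0 < e / (2 ^ n.+1)%:R)%R by rewrite divr_gt0// ltr0n expn_gt0.
  have [_ [U [oU FU] <-] /ltW] :=
    lb_ereal_inf_adherent en0 (stone_outer_fin_num (F n)).
  by exists U.
have {H} [U UP] := choice H.
apply: (@le_trans _ _ (stone_inner (\bigcup_n U n))).
  apply: stone_outer_le; first by apply: bigcup_open => n _; case: (UP n).
  by apply: subset_bigcup => n _; case: (UP n).
apply: le_trans (stone_inner_bigcup _) _; first by move=> n; case: (UP n).
apply: le_trans (epsilon_trick xpredT _ (ltW e0)) => [|n]; last first.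
  exact: stone_outer_ge0.
by apply: lee_nneseries => [n _ _|n _]; [exact: stone_inner_ge0|case: (UP n)].
Qed.

Definition stone_outer_measure : {outer_measure set (stone A) -> \bar R} :=
  HB.pack stone_outer
    (isOuterMeasure.Build R (stone A) stone_outer stone_outer0 stone_outer_ge0
       stone_outerS stone_outer_sigma_subadditive).

(** For a clopen [a] inside both sets, the part of [V] outside [U] is covered by the open part of
    [V] outside [a]. A clopen [b] in that open part is disjoint from [a], and their join still lies
    in [V], so [m a + m b] is at most the inner value of [V]. Suprema over [b] and then over [a]
    give the bound. *)
Lemma stone_outer_split U V : open U -> open V ->
  stone_inner (V `&` U) + stone_outer (V `&` ~` U) <= stone_inner V.
Proof.
move=> oU oV; rewrite -leeBrDr ?stone_outer_fin_num//.
apply: stone_inner_le => a aVU; rewrite leeBrDr ?stone_outer_fin_num//.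
have := aVU; rewrite subsetI => -[aV aU].
apply: (@le_trans _ _ ((m a)%:E + stone_inner (V `&` stone_basic (~` a)%O))).
  rewrite leeD2l//; apply: stone_outer_le.
    by apply: openI => //; exact: open_stone_basic.
  by rewrite stone_basicC; apply: setIS; exact: subsetC.
rewrite addeC -leeBrDr//; apply: stone_inner_le => b.
rewrite subsetI => -[bV /stone_basic_subset bCa]; rewrite leeBrDr// addeC.
rewrite -EFinD -boolean_probabilityU; last first.
  by apply/eqP; rewrite meetC disj_leC.
by apply: le_stone_inner; rewrite stone_basicU subUset.
Qed.

Lemma open_stone_caratheodory U : open U -> stone_outer.-caratheodory U.
Proof.
move=> oU; apply: (@le_caratheodory_measurable _ _ stone_outer_measure) => E.
(* The outer value of [E] is an infimum over open supersets, so the splitting inequality for open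
   [V] suffices. *)
apply: le_stone_outer => V oV EV.
apply: le_trans (stone_outer_split oU oV); apply: leeD.
  by apply: stone_outer_le; [exact: openI|exact: setSI].
by apply: stone_outerS; exact: setSI.
Qed.

End FinitelyAdditive.

(** Beyond the function, the packed structure holds only proofs, which proof irrelevance
    identifies. *)
Lemma eq_probability d (T : measurableType d) (R : realType)
  (P Q : probability T R) : P = Q :> (set T -> \bar R) -> P = Q.
Proof.
case: P Q => [P [[p1 p2] [p3] [p4] [p5] [p6] [p7] [p8]]].
case=> [Q [[q1 q2] [q3] [q4] [q5] [q6] [q7] [q8]]] /= PQ; subst Q.
rewrite (Prop_irrelevance q1 p1) (Prop_irrelevance q2 p2).
rewrite (Prop_irrelevance q3 p3) (Prop_irrelevance q4 p4).
rewrite (Prop_irrelevance q5 p5) (Prop_irrelevance q6 p6).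
by rewrite (Prop_irrelevance q7 p7) (Prop_irrelevance q8 p8).
Qed.

(** * Uniqueness and existence of the regular Borel measure with given clopen values *)

Section RegularExtension.
Context {R : realType} {d : Order.disp_t} {A : ctbDistrLatticeType d}.
Context (ntA : nontrivial A).
Local Notation X := (stone_space ntA).
Local Open Scope ereal_scope.

Lemma measurable_open_borel (U : set X) :
  open U -> measurable (U : set (borel X)).
Proof. by move=> oU; exact: sub_sigma_algebra. Qed.

Lemma measurable_stone_basic (a : A) :
  measurable (stone_basic a : set (borel X)).
Proof. by apply: measurable_open_borel; exact: open_stone_basic. Qed.

Lemma measurable_compact_borel (K : set X) :
  compact K -> measurable (K : set (borel X)).
Proof.
move=> /(compact_closed hausdorff_stone) cK; rewrite -[K]setCK.
by apply: measurableC; apply: measurable_open_borel; exact: closed_openC.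
Qed.

Lemma regular_measure_eq (mu nu : probability (borel X) R) :
  regular_probabilities mu -> regular_probabilities nu ->
  (forall a : A, mu (stone_basic a) = nu (stone_basic a)) -> mu = nu.
Proof.
have le (mu' nu' : probability (borel X) R) :
    regular_probabilities mu' -> regular_probabilities nu' ->
    (forall a : A, mu' (stone_basic a) = nu' (stone_basic a)) ->
    forall E, mu' E <= nu' E.
  move=> [rmu mu0] [rnu nu0] munu E.
  have [mE|nE] := pselect (measurable E); last by rewrite mu0// nu0.
  (* Outer regularity of [nu'] and inner regularity of [mu'] reduce the claim to a compact [K]
     inside an open [U], with a clopen set between them on which the measures agree. *)
  rewrite (rnu _ mE).1; apply: le_ereal_inf_tmp => _ [U [oU EU] <-].
  have mU := measurable_open_borel oU.
  apply: (@le_trans _ _ (mu' U)); first by apply: le_measure; rewrite ?inE.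
  rewrite (rmu _ mU).2; apply: ge_ereal_sup => _ [K [cK KU] <-].
  have [a [Ka aU]] := compact_sub_stone_basic cK oU KU.
  have ma := measurable_stone_basic a.
  have mK : measurable (K : set (borel X)).
    exact: measurable_compact_borel.
  apply: (@le_trans _ _ (mu' (stone_basic a))).
    by apply: le_measure; rewrite ?inE.
  by rewrite munu; apply: le_measure; rewrite ?inE.
move=> rmu rnu munu.
by apply/eq_probability/funext => E; apply/eqP; rewrite eq_le !le.
Qed.

Context (m : A -> R) (mP : boolean_probability m).

(** The Caratheodory sets form a sigma-algebra containing the open sets, hence all Borel sets. *)
Lemma measurable_stone_outer (E : set (borel X)) :
  measurable E -> (stone_outer m).-caratheodory E.
Proof.
apply: (@smallest_sub _ _ _ (stone_outer m).-caratheodory).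
  split.
  - exact: (caratheodory_measurable_set0 (stone_outer_measure mP)).
  - move=> E' mE'; rewrite setTD.
    exact: (@caratheodory_measurable_setC _ _ (stone_outer_measure mP)).
  - exact: (@caratheodory_measurable_bigcup _ _ (stone_outer_measure mP)).
by move=> U; exact: open_stone_caratheodory.
Qed.

Lemma stone_outer_sigma_additive (F : (set (borel X))^nat) :
  (forall n, measurable (F n)) -> trivIset setT F ->
  measurable (\bigcup_n F n) ->
  (fun n => \sum_(0 <= i < n) stone_outer m (F i)) @ \oo -->
    stone_outer m (\bigcup_n F n).
Proof.
move=> mF tF mUF.
apply: (@caratheodory_measure_sigma_additive R X (stone_outer_measure mP)) => //.
  by move=> n; exact: measurable_stone_outer.
exact: measurable_stone_outer.
Qed.

(* The unused proof argument lets the canonical measure structures below, which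
   exist only under that hypothesis, be inferred from the function. *)
Definition stone_measure (_ : boolean_probability m) (E : set (borel X)) :
  \bar R := if `[< measurable E >] then stone_outer m E else 0.

Local Notation mu := (stone_measure mP).

Lemma stone_measureE E : measurable E -> mu E = stone_outer m E.
Proof. by move=> mE; rewrite /stone_measure; case: asboolP. Qed.

Lemma stone_measure_nonmeasurable E : ~ measurable E -> mu E = 0.
Proof. by move=> nE; rewrite /stone_measure; case: asboolP. Qed.

Let mu0 : mu set0 = 0.
Proof. by rewrite stone_measureE// stone_outer0. Qed.

Let mu_ge0 E : 0 <= mu E.
Proof.
by rewrite /stone_measure; case: ifP => // _; exact: stone_outer_ge0.
Qed.

Let mu_sigma_additive : semi_sigma_additive mu.
Proof.
move=> F mF tF mUF; rewrite stone_measureE//.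
under eq_fun do under eq_bigr do rewrite stone_measureE//.
exact: stone_outer_sigma_additive.
Qed.

HB.instance Definition _ := isMeasure.Build _ (borel X) R mu
  mu0 mu_ge0 mu_sigma_additive.

Let muT : mu setT = 1.
Proof. by rewrite stone_measureE//; exact: stone_outerT. Qed.

HB.instance Definition _ := Measure_isProbability.Build _ (borel X) R mu muT.

Lemma stone_measure_basic a : mu (stone_basic a) = (m a)%:E.
Proof.
rewrite stone_measureE; last exact: measurable_stone_basic.
exact: stone_outer_basic.
Qed.

Lemma stone_measure_outer_regular E : measurable E -> mu E =
  ereal_inf [set mu U | U in [set U : set X | open U /\ E `<=` U]].
Proof.
move=> mE; rewrite stone_measureE// /stone_outer; congr (ereal_inf _).
apply: eq_imagel => U [oU _].
rewrite stone_measureE; last exact: measurable_open_borel.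
exact/esym/stone_outer_open.
Qed.

Lemma stone_measure_regular : regular_probabilities mu.
Proof.
split; last exact: stone_measure_nonmeasurable.
move=> E mE; split; first exact: stone_measure_outer_regular.
apply/eqP; rewrite eq_le; apply/andP; split; last first.
  apply: ge_ereal_sup => _ [K [cK KE] <-].
  by apply: le_measure; rewrite ?inE//; exact: measurable_compact_borel.
(* An open [V] containing the complement of [E], with excess measure below [e], has a complement
   that is compact, lies in [E] and loses less than [e]. *)
have mCE : measurable (~` E) by exact: measurableC.
apply/lee_addgt0Pr => e e0.
have := stone_measure_outer_regular mCE; set I := ereal_inf _ => muCE.
have Ifin : I \is a fin_num by rewrite -muCE fin_num_measure.
have [_ [V [oV EV] <-]] := lb_ereal_inf_adherent e0 Ifin.
rewrite -/I -muCE => VE.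
have mV := measurable_open_borel oV.
apply: (@le_trans _ _ (mu (~` V) + e%:E)); last first.
  rewrite leeD2r//; apply: ereal_sup_ubound; exists (~` V) => //; split.
    by apply: closed_stone_compact; exact: open_closedC.
  by rewrite -[E]setCK; exact: subsetC.
have CE : mu E = 1 - mu (~` E).
  by rewrite -[in LHS](setCK E); exact: probability_setC.
have CV : mu (~` V) = 1 - mu V by exact: probability_setC.
change (mu E <= mu (~` V) + e%:E).
rewrite CE CV; move: VE; rewrite -(fineK (fin_num_measure mu _ mV)).
rewrite -(fineK (fin_num_measure mu _ mCE)) -!EFinB -!EFinD lte_fin lee_fin.
lra.
Qed.

End RegularExtension.

Section ProbabilityOfMeasure.
Context {R : realType} {d : Order.disp_t} {A : ctbDistrLatticeType d}.
Context (ntA : nontrivial A).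

Lemma boolean_probability_measure
    (mu : probability (borel (stone_space ntA)) R) :
  boolean_probability (fun a : A => fine (mu (stone_basic a))).
Proof.
have mb := @measurable_stone_basic _ A ntA.
split=> [a||a b ab].
- exact: fine_ge0.
- by rewrite stone_basicT probability_setT.
- rewrite -fineD ?fin_num_measure//; congr fine.
  by rewrite stone_basicU measureU// -stone_basicI ab stone_basic0.
Qed.

End ProbabilityOfMeasure.

(** * States and the Booleanisation *)

Section Booleanisation.
Local Open Scope order_scope.
Context {d d' : Order.disp_t} (S : direct_system d d').
Implicit Types (x y : plonka S) (u v : booleanisation S).

Lemma pl_classU x y : pl_class (pl_join x y) = pl_class x `|` pl_class y.
Proof. exact/esym/bz_joinE. Qed.

Lemma pl_classI x y : pl_class (pl_meet x y) = pl_class x `&` pl_class y.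
Proof. exact/esym/bz_meetE. Qed.

Lemma pl_class_map x k (xk : tag x <= k) :
  pl_class (pl_elt (ds_map xk (tagged x))) = pl_class x.
Proof.
apply: (@pl_class_eq _ _ S _ _ k) => //= kk xk'.
by rewrite ds_map_id (bool_irrelevance xk xk').
Qed.

Lemma pl_class_bot i :
  pl_class (pl_elt (\bot : ds_alg i)) = \bot :> booleanisation S.
Proof.
apply: (@pl_class_eq _ _ S _ (pl_zero S) i) => [||? ?]; first exact: lexx.
  exact: le0x.
by rewrite !ds_map0.
Qed.

Lemma pl_class_common u v : exists k (a b : ds_alg k),
  u = pl_class (pl_elt a) /\ v = pl_class (pl_elt b).
Proof.
rewrite -(pl_class_repr u) -(pl_class_repr v).
set x := repr u; set y := repr v; exists (tag x `|` tag y).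
exists (ds_map (leUl (tag x) (tag y)) (tagged x)).
exists (ds_map (leUr (tag y) (tag x)) (tagged y)).
by rewrite !pl_class_map.
Qed.

(** Representatives in a common component need not be disjoint there; their meet is only sent to
    zero at some later index, so both are pushed forward to that index. *)
Lemma pl_class_disjoint u v : u `&` v = \bot -> exists k (a b : ds_alg k),
  [/\ u = pl_class (pl_elt a), v = pl_class (pl_elt b) & a `&` b = \bot].
Proof.
have [k [a [b [-> ->]]]] := pl_class_common u v.
rewrite -pl_classI => /pl_classP/pl_equivP[l [hab [h0 e]]].
have h : k <= l by exact: le_trans (leUl k k) hab.
exists l, (ds_map h a), (ds_map h b); split.
- by rewrite (@pl_class_map (pl_elt a)).
- by rewrite (@pl_class_map (pl_elt b)).
- move: e; rewrite ds_map0.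
  by rewrite (@ds_map_pl_meet _ _ _ (pl_elt a) (pl_elt b) _ hab h h).
Qed.

End Booleanisation.

(** * Factoring states through the Booleanisation *)

Section StateFactorisation.
Context {R : realType} {B : invBisemilatticeType} {d d' : Order.disp_t}.
Context (S : direct_system d d') (f : B -> plonka S).
Context (f_iso : ibs_isomorphism f).

Lemma state_of_boolean_probability (m : booleanisation S -> R) :
  boolean_probability m -> states f (fun b => m (pl_class (f b))).
Proof.
case: f_iso => _ fI fU _ [_ f1] mP; split=> [b||a b [i abi]].
- by rewrite boolean_probability_ge0// boolean_probability_le1.
- by rewrite f1; case: mP => _ + _; exact.
- rewrite fU [X in m X]pl_classU boolean_probabilityU//.
  by rewrite -pl_classI -[pl_meet _ _]fI abi pl_class_bot.
Qed.

Section Factor.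
Context (g : plonka S -> B) (fK : cancel f g) (gK : cancel g f).
Context (s : B -> R) (sP : states f s).

Lemma state_pl_join x y i : pl_meet x y = pl_elt (\bot%O : ds_alg i) ->
  s (g (pl_join x y)) = s (g x) + s (g y).
Proof.
case: f_iso sP => _ fI fU _ _ [_ _ sU] xyi; rewrite -sU.
  by congr s; rewrite -[RHS]fK fU !gK.
by exists i; rewrite fI !gK.
Qed.

Lemma state_bot i : s (g (pl_elt (\bot%O : ds_alg i))) = 0.
Proof.
(* A local zero is disjoint from itself, so additivity makes its value equal to twice itself. *)
set z := pl_elt _; have zz : pl_meet z z = z.
  by rewrite pl_meetE pl_joinxx pl_invK.
have := state_pl_join zz; rewrite pl_joinxx => /eqP.
by rewrite -subr_eq0 opprD addNKr oppr_eq0 => /eqP.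
Qed.

(* With [z] the zero of the component [k], the join of [x] and [z] is the image
   of [x] in that component, and their meet is [z], so additivity applies. *)
Lemma state_map x k (xk : (tag x <= k)%O) :
  s (g (pl_elt (ds_map xk (tagged x)))) = s (g x).
Proof.
set z := pl_elt (\bot%O : ds_alg k).
have xz : pl_meet x z = z.
  apply: pl_eq => [|l h zl] /=; first exact: join_r.
  rewrite (@ds_map_pl_meet _ _ _ x z _ h (le_trans xk zl) zl) /= ds_map0.
  by rewrite meetx0.
have <- : pl_join x z = pl_elt (ds_map xk (tagged x)).
  apply: pl_eq => [|l h zl] /=; first exact: join_r.
  rewrite (@ds_map_pl_join _ _ _ x z _ h (le_trans xk zl) zl) /= ds_map0.
  by rewrite joinx0 (ds_map_comp xk zl).
by rewrite (state_pl_join xz) state_bot addr0.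
Qed.

Lemma state_pl_equiv x y : pl_class x = pl_class y -> s (g x) = s (g y).
Proof.
move=> /pl_classP/pl_equivP[k [xk [yk e]]].
by rewrite -(state_map xk) -(state_map yk) e.
Qed.

End Factor.

Lemma state_factor (s : B -> R) : states f s ->
  exists2 m : booleanisation S -> R, boolean_probability m &
    forall b, s b = m (pl_class (f b)).
Proof.
move=> sP; have [[g fK gK] _ _ _ [_ f1]] := f_iso.
pose m (u : booleanisation S) := s (g (repr u)).
have mE x : m (pl_class x) = s (g x).
  by apply: (state_pl_equiv fK gK sP); rewrite pl_class_repr.
exists m => [|b]; last by rewrite mE fK.
case: (sP) => s01 s1 _; split=> [u||u v uv].
- by case/andP: (s01 (g (repr u))).
- by rewrite [\top%O]/(pl_class (pl_one S)) mE -[pl_one S]f1 fK.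
(* Additivity of [s] needs representatives whose meet is a local zero, which arbitrary
   representatives of [u] and [v] need not have. *)
have [k [a [b [-> -> ab]]]] := pl_class_disjoint uv.
rewrite -pl_classU !mE; apply: (state_pl_join fK gK sP (i := k)).
apply: pl_eq => [|l h kl] /=; first exact: joinxx.
rewrite (@ds_map_pl_meet _ _ _ (pl_elt a) (pl_elt b) _ h kl kl) /=.
by rewrite -ds_mapI ab.
Qed.

End StateFactorisation.

(** * The bijection between states and regular measures, and the integral formula *)

Theorem theorem3p8 (R : realType) (B : invBisemilatticeType)
    (d d' : Order.disp_t) (S : direct_system d d') (f : B -> plonka S)
    (f_iso : ibs_isomorphism f)
    (B_nontrivial : exists a b : B, a <> b)
    (S_nontrivial : no_trivial_algebra S) :
  let X := stone_space (booleanisation_nontrivial S_nontrivial) in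
  exists chi : (B -> R) -> probability (borel X) R,
    set_bij (states f) (@regular_probabilities R X) chi /\
    forall s : B -> R, states f s -> forall b : B,
      (s b)%:E =
        (\int[chi s]_(M in [set: borel X])
           (\1_(stone_basic (pl_class (f b))) M)%:E)%E.
Proof.
move=> X.
have /choice[chi chiP] (s : B -> R) : exists mu : probability (borel X) R,
    states f s -> regular_probabilities mu /\
      forall b, mu (stone_basic (pl_class (f b))) = (s b)%:E.
  have [sP|nsP] := pselect (states f s); last first.
    (* [chi] is total on functions from [B] to [R]; the Dirac measure is a default value off the
       states. *)
    by exists (dirac (point : borel X)) => /nsP.
  have [m mP sm] := state_factor f_iso sP.
  exists (stone_measure (ntA := booleanisation_nontrivial S_nontrivial) mP).
  move=> _; split; first exact: stone_measure_regular.
  by move=> b; rewrite sm; exact: stone_measure_basic.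
exists chi; split; last first.
  move=> s /chiP[_ chis] b; rewrite integral_indic//.
    by rewrite setIT; exact/esym/chis.
  exact: measurable_stone_basic.
(* Injectivity holds because the clopen values of [chi s] give back [s]. *)
split=> [s /chiP[]//|s s' /set_mem sP /set_mem s'P ss'|mu rmu].
  apply/funext => b; apply: EFin_inj.
  by rewrite -(chiP _ sP).2 -(chiP _ s'P).2 ss'.
(* For surjectivity, the preimage of [mu] is the state of its clopen values. As every class comes
   from some [f b], [mu] and the image of that state agree on all clopen sets, hence coincide by
   regularity. *)
have sP := state_of_boolean_probability f_iso (boolean_probability_measure mu).
exists (fun b => fine (mu (stone_basic (pl_class (f b))))) => //.
have [rchi chiE] := chiP _ sP; apply: regular_measure_eq => // a.
have [[g fK gK] _ _ _ _] := f_iso.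
rewrite -[a]pl_class_repr -[repr a]gK chiE fineK//.
by apply: fin_num_measure; exact: measurable_stone_basic.
Qed.
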